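(* Let $e\in\mathbb{N}$, $a,b\in\mathbb{N}$ and $\mathbb{F}_q=\{\alpha_1,\dots,\alpha_q\}$. The evaluation code $C_e(a,b)$ on the $\mathbb{F}_q$-rational points of the Hirzebruch surface $\mathcal{H}_e$ is given by $$C_e(a,b)=\sum_{d_1=0}^{a}\Big[\big\langle(0^{d_1},\alpha_1^{a-d_1},\dots,\alpha_q^{a-d_1})\big\rangle\otimes\mathrm{PRS}_q(b-ea+ed_1+1)\Big].$$
   Context: $q$ is a prime power, $\mathbb{F}_q=\{\alpha_1,\dots,\alpha_q\}$ is the field with $q$ elements, $\mathbb{N}=\{0,1,2,\dots\}$, and $0^0:=1$; $\langle\cdot\rangle$ denotes linear span. Tensor products: for $C_1\subset\mathbb{F}_q^{n_1}$, $C_2\subset\mathbb{F}_q^{n_2}$, $C_1\otimes C_2$ is the space of $n_2\times n_1$ matrices whose rows lie in $C_1$ and whose columns lie in $C_2$. Projective Reed–Solomon codes: for $1\le k\le q+1$, $\mathrm{PRS}_q(k)\subset\mathbb{F}_q^{q+1}$ is the set of vectors $(P(0,1),P(1,\alpha_1),\dots,P(1,\alpha_q))$ with $P\in\mathbb{F}_q[X,Y]$ homogeneous of degree $k-1$ (or zero); $\mathrm{PRS}_q(k)=\{0\}$ for $k\le 0$ and $\mathrm{PRS}_q(k)=\mathbb{F}_q^{q+1}$ for $k\ge q+1$. The code $C_e(a,b)$: the $\mathbb{F}_q$-points of $\mathcal{H}_e$ are identified with $\mathbb{P}^1(\mathbb{F}_q)\times\mathbb{P}^1(\mathbb{F}_q)$,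 and representatives of $\mathbb{P}^1(\mathbb{F}_q)$ are chosen in the order $(0,1),(1,\alpha_1),\dots,(1,\alpha_q)$. Let $L_*(aS_e+bF_e)$ be the $\mathbb{F}_q$-span of the monomials $X_1^{d_1}X_2^{d_2}T_1^{c_1}T_2^{c_2}$ with nonnegative exponents satisfying $d_1+d_2=a$ and $c_1+c_2-ed_1=b-ea$. Then $C_e(a,b)\subset\mathbb{F}_q^{(q+1)^2}$ is the set of $(q+1)\times(q+1)$ matrices $\big(f(x_1,x_2,t_1,t_2)\big)$, $f\in L_*(aS_e+bF_e)$, with rows indexed by the representatives $(t_1,t_2)$ and columns by the representatives $(x_1,x_2)$. *)

(* Defs.v *)
From HB Require Import structures.
From mathcomp Require Import all_boot all_order all_algebra.
From mathcomp Require Export mpoly.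
Set Implicit Arguments.
Unset Strict Implicit.
Unset Printing Implicit Defensive.
Import GRing.Theory.
Local Open Scope ring_scope.

(* Membership in the linear span of an arbitrary, possibly infinite, set S of
   vectors of a possibly infinite-dimensional space. *)
Definition in_span (K : fieldType) (V : lmodType K) (S : V -> Prop) (v : V) :
    Prop :=
  exists (n : nat) (c : 'I_n -> K) (w : 'I_n -> V),
    (forall i, S (w i)) /\ v = \sum_(i < n) c i *: w i.

Section Tensor.
Variables (K : fieldType) (n1 n2 : nat).

Definition row_hom (i : 'I_n2) : 'Hom('M[K]_(n2, n1), 'rV[K]_n1) :=
  linfun (row i).

Definition col_hom (j : 'I_n1) : 'Hom('M[K]_(n2, n1), 'rV[K]_n2) :=
  linfun (trmx \o col j).

(* Codewords are row vectors, so columns are transposed; see memv_tensor. *)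
Definition tensor (C1 : {vspace 'rV[K]_n1}) (C2 : {vspace 'rV[K]_n2}) :
    {vspace 'M[K]_(n2, n1)} :=
  (\bigcap_(i < n2) (row_hom i @^-1: C1)
   :&: \bigcap_(j < n1) (col_hom j @^-1: C2))%VS.

Lemma memv_tensor (C1 : {vspace 'rV[K]_n1}) (C2 : {vspace 'rV[K]_n2})
    (M : 'M[K]_(n2, n1)) :
  reflect ((forall i, row i M \in C1) /\ (forall j, (col j M)^T \in C2))
          (M \in tensor C1 C2).
Proof.
have memE (V : {vspace 'M[K]_(n2, n1)}) : (M \in V) = (<[M]> <= V)%VS by [].
rewrite memv_cap; apply: (iffP andP) => -[].
  rewrite !memE => /subv_bigcapP H1 /subv_bigcapP H2; split=> k.
    by have := H1 k isT; rewrite -memE -memv_preim lfunE.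
  by have := H2 k isT; rewrite -memE -memv_preim lfunE.
move=> H1 H2; rewrite !memE; split; apply/subv_bigcapP => k _;
  by rewrite -memE -memv_preim lfunE /=.
Qed.

End Tensor.

Section Codes.
Variables (F : finFieldType) (q : nat) (alpha : 'I_q -> F).

(* Representatives of P^1(F), in the order (0,1), (1,alpha_1), (1,alpha_2)
   and so on. *)
Definition P1rep (i : 'I_q.+1) : 2.-tuple F :=
  if unlift ord0 i is Some j then [tuple 1; alpha j] else [tuple 0; 1].

Definition PRS_eval d (P : dhomog 2 F d) : 'rV[F]_q.+1 :=
  \row_i (P : {mpoly F[2]}).@[tnth (P1rep i)].

Fact PRS_eval_is_linear d : linear (@PRS_eval d).
Proof. by move=> c P Q; apply/rowP=> i; rewrite !mxE /= mevalD mevalZ. Qed.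

HB.instance Definition _ d :=
  GRing.isLinear.Build F (dhomog 2 F d) 'rV[F]_q.+1 _ (@PRS_eval d)
    (@PRS_eval_is_linear d).

(* The pattern Posz d.+1 is k = d + 1 >= 1, so that d = k - 1. *)
Definition PRS (k : int) : {vspace 'rV[F]_q.+1} :=
  if k is Posz d.+1 then
    if (d <= q)%N then limg (linfun (@PRS_eval d)) else fullv
  else 0%VS.

Lemma memv_PRS d (v : 'rV[F]_q.+1) : (d <= q)%N ->
  (v \in PRS d.+1%:Z) <->
  exists2 P : {mpoly F[2]}, P \is d.-homog &
    v = \row_i P.@[tnth (P1rep i)].
Proof.
move=> dq; rewrite /PRS dq; split.
  by case/memv_imgP=> P _ ->; exists P; [exact: dhomog_is_dhomog | rewrite lfunE].
case=> P hP ->; apply/memv_imgP; exists (DHomog hP); first exact: memvf.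
by rewrite lfunE.
Qed.

(* The variables of {mpoly F[4]} are X_1, X_2, T_1, T_2, in this order. *)
Definition Lstar_monomial (e a b : nat) (p : {mpoly F[4]}) : Prop :=
  exists d1 d2 c1 c2 : nat,
    [/\ (d1 + d2 = a)%N,
        c1%:Z + c2%:Z - e%:Z * d1%:Z = b%:Z - e%:Z * a%:Z
      & p = 'X_[Multinom [tuple d1; d2; c1; c2]]].

Definition Lstar (e a b : nat) : {mpoly F[4]} -> Prop :=
  in_span (Lstar_monomial e a b).

(* Rows are indexed by (t_1, t_2), columns by (x_1, x_2). *)
Definition eval_mx (f : {mpoly F[4]}) : 'M[F]_(q.+1, q.+1) :=
  \matrix_(i, j) f.@[tnth [tuple of P1rep j ++ P1rep i]].

Definition Ce (e a b : nat) (M : 'M[F]_(q.+1, q.+1)) : Prop :=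
  exists2 f, Lstar e a b f & M = eval_mx f.

(* (0^d1, alpha_1^(a-d1), ..., alpha_q^(a-d1)); note 0 ^+ 0 = 1. *)
Definition xvec (a d1 : nat) : 'rV[F]_q.+1 :=
  \row_j (if unlift ord0 j is Some i then alpha i ^+ (a - d1) else 0 ^+ d1).

End Codes.

(* Main.v *)
Require Import Defs.
From mathcomp Require Import all_boot all_order all_algebra finfield.
Import GRing.Theory.
Local Open Scope ring_scope.

(** Evaluating [X1^d1 X2^d2 T1^c1 T2^c2] gives the rank-one matrix
    [(xvec (c1 + c2) c1)^T *m xvec a d1], so [C_e(a,b)] is spanned by these
    matrices. On the other side a tensor with a line [<[v]>], [v != 0], consists
    of the matrices [u^T *m v], and [PRS(d + 1)] is spanned by the vectors
    [xvec d k]. For [d > q] the latter says that every vector is the evaluation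
    of a form of degree [d]: prescribe the leading coefficient by the value at
    (0,1), then correct the other values by interpolation in degree < q. *)

Section Span.
Variables (K : fieldType) (V : lmodType K) (S : V -> Prop).

Lemma in_span0 : in_span S 0.
Proof.
by exists 0%N, (fun=> 0), (fun=> 0); split; [case | rewrite big_ord0].
Qed.

Lemma in_span_gen v : S v -> in_span S v.
Proof.
move=> Sv; exists 1%N, (fun=> 1), (fun=> v).
by split=> //; rewrite big_ord1 scale1r.
Qed.

Lemma in_spanZ c v : in_span S v -> in_span S (c *: v).
Proof.
case=> n [x [w [Sw ->]]]; exists n, (fun i => c * x i), w; split=> //.
by rewrite scaler_sumr; apply: eq_bigr => i _; rewrite scalerA.
Qed.

Lemma in_spanD u v : in_span S u -> in_span S v -> in_span S (u + v).
Proof.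
case=> n1 [c1 [w1 [S1 ->]]] [n2 [c2 [w2 [S2 ->]]]].
exists (n1 + n2)%N.
exists (fun i => match split i with inl j => c1 j | inr j => c2 j end).
exists (fun i => match split i with inl j => w1 j | inr j => w2 j end).
split=> [i|]; first by case: (split i).
rewrite big_split_ord; congr (_ + _); apply: eq_bigr => i _.
  by rewrite (unsplitK (inl i)).
by rewrite (unsplitK (inr i)).
Qed.

End Span.

(** Each row of [M] is a multiple of [v], and the multipliers form [u]. Since [v] has a nonzero
    entry [v 0 j], they can be read off column [j] of [M] divided by [v 0 j], so [u] lies in [C]. *)
Lemma memv_tensor_line (K : fieldType) (n1 n2 : nat) (v : 'rV[K]_n1)
    (C : {vspace 'rV[K]_n2}) (M : 'M[K]_(n2, n1)) : v != 0 ->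
  M \in tensor <[v]> C <-> exists2 u, u \in C & M = u^T *m v.
Proof.
move=> v0; split=> [/memv_tensor [Mrow Mcol] | [u uC ->]]; last first.
  apply/memv_tensor; split=> k.
    apply/vlineP; exists (u 0 k); apply/rowP=> j.
    by rewrite !mxE big_ord1 !mxE.
  suff -> : (col k (u^T *m v))^T = v 0 k *: u by apply: memvZ.
  by apply/rowP=> i; rewrite !mxE big_ord1 !mxE mulrC.
have [j vj] : exists j, v 0 j != 0 by apply/rV0Pn.
exists ((v 0 j)^-1 *: (col j M)^T); first exact: memvZ.
apply/matrixP=> i k; rewrite mxE big_ord1 !mxE.
have /vlineP [c /rowP Mi] := Mrow i.
have := Mi j; have := Mi k; rewrite !mxE => -> ->.
by rewrite mulrCA mulVf // mulr1.
Qed.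

Section Hirzebruch.
Variables (F : finFieldType) (q : nat) (alpha : 'I_q -> F).

Local Notation xvec := (xvec alpha).
Local Notation P1rep := (P1rep alpha).
Local Notation PRS := (PRS alpha).

(** Both cases of [xvec] are values of the one monomial X^d Y^(a-d) at the representatives of P^1;
    this relies on 0^0 = 1. *)
Lemma xvecE a d j :
  xvec a d 0 j = tnth (P1rep j) 0 ^+ d * tnth (P1rep j) 1 ^+ (a - d).
Proof.
rewrite mxE /Defs.P1rep; case: unliftP => [i _|_] /=.
  by rewrite !(tnth_nth 0) /= expr1n mul1r.
by rewrite !(tnth_nth 0) /= expr1n mulr1.
Qed.

Lemma limg_PRS_eval d :
  limg (linfun (@PRS_eval F q alpha d)) = (\sum_(k < d.+1) <[xvec d k]>)%VS.
Proof.
apply/eqP; rewrite eqEsubv; apply/andP; split.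
  apply/subvP=> _ /memv_imgP [P _ ->]; rewrite lfunE /=.
  have -> : PRS_eval alpha P =
      \sum_(m <- msupp (P : {mpoly F[2]})) (P : {mpoly F[2]})@_m *: xvec d (m 0).
    apply/rowP=> j; rewrite mxE mevalE summxE.
    rewrite [LHS]big_seq [RHS]big_seq; apply: eq_bigr => m mP.
    rewrite mxE xvecE.
    (* By homogeneity the first exponent determines the second. *)
    have <- : m (lift ord0 ord0) = (d - m 0%R)%N.
      have /dhomogP /(_ m mP) /= <- := dhomog_is_dhomog P.
      by rewrite mdegE !big_ord_recl big_ord0 addn0 addKn.
    rewrite !big_ord_recl big_ord0 mulr1.
    by congr (_ * (_ * tnth _ _ ^+ _)); apply: val_inj.
  rewrite big_seq; apply: memv_suml => m mP; apply: memvZ.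
  have /dhomogP /(_ m mP) := dhomog_is_dhomog P.
  rewrite /= mdegE big_ord_recl => dm.
  have md : (m 0%R < d.+1)%N by rewrite ltnS -dm leq_addr.
  by apply: (subvP (sumv_sup (Ordinal md) _ (subvv _))); rewrite ?memv_line.
apply/subv_sumP => k _; rewrite -memvE.
have hom : 'X_[F, Multinom [tuple (k : nat); (d - k)%N]] \is d.-homog.
  rewrite dhomogX /= mdegE !big_ord_recl big_ord0 /= !mnm_tnth !(tnth_nth 0%N) /=.
  by rewrite addn0 subnKC // -ltnS.
apply/memv_imgP; exists (DHomog hom); first exact: memvf.
rewrite lfunE; apply/rowP=> j; rewrite xvecE mxE /= mevalX.
rewrite !big_ord_recl big_ord0 /= !mnm_tnth !(tnth_nth 0%N) /= mulr1.
by congr (tnth _ _ ^+ _ * tnth _ _ ^+ _); apply: val_inj.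
Qed.

Hypothesis alpha_bij : bijective alpha.

Lemma card_alpha : q = #|F|.
Proof. by rewrite -(bij_eq_card alpha_bij) card_ord. Qed.

Lemma xvec_neq0 a d : xvec a d != 0.
Proof.
have [g _ gK] := alpha_bij.
apply/eqP => /rowP /(_ (lift ord0 (g 1))).
by rewrite !mxE liftK gK expr1n => /eqP; rewrite oner_eq0.
Qed.

(** As z^(#|F|-1) = 1 for z != 0, the polynomial 1 - (X - y)^(#|F|-1) is the indicator function of
    y, and it has size at most #|F|. *)
Lemma finField_interpolation (g : F -> F) :
  exists2 p : {poly F}, (size p <= #|F|)%N & forall x, p.[x] = g x.
Proof.
have F0 : (0 < #|F|)%N by apply/card_gt0P; exists 0.
exists (\sum_y g y *: (1 - ('X - y%:P) ^+ #|F|.-1)).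
  apply: leq_trans (size_sum _ _ _) _; apply/bigmax_leqP=> y _.
  apply: leq_trans (size_scale_leq _ _) _.
  apply: leq_trans (size_polyD _ _) _.
  by rewrite size_polyN size_exp_XsubC size_poly1 prednK // geq_max F0 leqnn.
move=> x; rewrite horner_sum (bigD1 x) //= big1 => [|y yx]; rewrite !hornerE.
  rewrite subrr expr0n.
  have -> : (#|F|.-1 == 0)%N = false.
    by rewrite -subn1 subn_eq0 leqNgt finNzRing_gt1.
  by rewrite subr0 mulr1.
have xy : x - y != 0 by rewrite subr_eq0 eq_sym.
have -> : (x - y) ^+ #|F|.-1 = 1.
  by apply: (mulfI xy); rewrite -exprS prednK // expf_card mulr1.
by rewrite subrr mulr0.
Qed.

Lemma sum_xvec_full d : (q < d)%N ->
  (\sum_(k < d.+1) <[xvec d k]>)%VS = fullv.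
Proof.
move=> qd; apply/eqP; rewrite eqEsubv subvf; apply/subvP=> u _.
have [g gK _] := alpha_bij.
pose u0 := u 0 ord0.
(* The term [u0 * x ^+ d] is subtracted in advance, so that [r] below has leading coefficient [u0]
   and still takes the prescribed affine values. *)
have [p szp pE] :=
  finField_interpolation (fun x => u 0 (lift ord0 (g x)) - u0 * x ^+ d).
pose r := u0 *: 'X^d + p.
have szr : (size r <= d.+1)%N.
  apply: leq_trans (size_polyD _ _) _; rewrite geq_max; apply/andP; split.
    by apply: leq_trans (size_scale_leq _ _) _; rewrite size_polyXn.
  by apply: leq_trans szp _; rewrite -card_alpha ltnW // ltnS ltnW.
(* As #|F| = q < d, the correction [p] does not reach degree d. *)
have rd : r`_d = u0.
  rewrite coefD coefZ coefXn eqxx mulr1 (nth_default _ (leq_trans szp _)).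
    by rewrite addr0.
  by rewrite -card_alpha ltnW.
have -> : u = \sum_(k < d.+1) r`_(d - k) *: xvec d k.
  apply/rowP=> j; rewrite summxE.
  under eq_bigr => k _ do rewrite 2!mxE.
  case: unliftP => [i ->|->].
    transitivity r.[alpha i].
      by rewrite hornerD hornerZ hornerXn pE gK addrC subrK.
    rewrite (horner_coef_wide _ szr) (reindex_inj rev_ord_inj) /=.
    by apply: eq_bigr => k _; rewrite subSS.
  rewrite big_ord_recl subn0 expr0 mulr1 rd big1 ?addr0 // => k _.
  by rewrite expr0n mulr0.
by apply: memv_sumr => k _; rewrite memvZ // memv_line.
Qed.

(** One description for both branches of [PRS], so that the main proof needs no comparison of d with
    q. *)
Lemma PRS_sum d : PRS d.+1%:Z = (\sum_(k < d.+1) <[xvec d k]>)%VS.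
Proof.
rewrite /Defs.PRS; case: leqP => qd; first exact: limg_PRS_eval.
by rewrite sum_xvec_full.
Qed.

Lemma eval_mx_monomial (d1 d2 c1 c2 : nat) :
  eval_mx alpha 'X_[Multinom [tuple d1; d2; c1; c2]] =
  (xvec (c1 + c2) c1)^T *m xvec (d1 + d2) d1.
Proof.
apply/matrixP=> i j; rewrite mxE [RHS]mxE big_ord1 mxE !xvecE !addKn mevalX.
rewrite !big_ord_recl big_ord0 /= !mnm_tnth !(tnth_nth 0%N) !(tnth_nth 0) /=.
rewrite mulr1 mulrA mulrC.
(* The entries of the concatenated tuple compute once the X-representative is a literal pair. *)
by case: (P1rep j) => -[|? [|? []]].
Qed.

Lemma eval_mx0 : eval_mx alpha 0 = 0.
Proof. by apply/matrixP=> i j; rewrite !mxE meval0. Qed.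

Lemma eval_mxD f g : eval_mx alpha (f + g) = eval_mx alpha f + eval_mx alpha g.
Proof. by apply/matrixP=> i j; rewrite !mxE mevalD. Qed.

Lemma eval_mxZ c f : eval_mx alpha (c *: f) = c *: eval_mx alpha f.
Proof. by apply/matrixP=> i j; rewrite !mxE mevalZ. Qed.

Lemma Ce_sum e a b I (r : seq I) (P : pred I) (G : I -> 'M[F]_(q.+1, q.+1)) :
  (forall i, P i -> Ce alpha e a b (G i)) ->
  Ce alpha e a b (\sum_(i <- r | P i) G i).
Proof.
move=> CG; apply: big_ind => //.
  by exists 0; [exact: in_span0 | rewrite eval_mx0].
move=> _ _ [f Lf ->] [g Lg ->].
by exists (f + g); [exact: in_spanD | rewrite eval_mxD].
Qed.

End Hirzebruch.

Theorem proposition2p8 (F : finFieldType) (q : nat) (alpha : 'I_q -> F)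
    (alpha_bij : bijective alpha) (e a b : nat) (M : 'M[F]_(q.+1, q.+1)) :
  Ce alpha e a b M <->
  M \in (\sum_(d1 < a.+1)
           tensor <[xvec alpha a d1]>
             (PRS alpha (b%:Z - e%:Z * a%:Z + e%:Z * d1%:Z + 1)))%VS.
Proof.
split.
  case=> _ [n [c [w [Lw ->]]]] ->.
  rewrite (big_morph _ (eval_mxD F q alpha) (eval_mx0 F q alpha)).
  apply: memv_suml => i _; rewrite eval_mxZ; apply: memvZ.
  have [d1 [d2 [c1 [c2 [da cb ->]]]]] := Lw i; rewrite eval_mx_monomial da.
  have d1a : (d1 < a.+1)%N by rewrite ltnS -da leq_addr.
  apply: (subvP (sumv_sup (Ordinal d1a) _ (subvv _))) => //=.
  apply/memv_tensor_line; first exact: xvec_neq0.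
  exists (xvec alpha (c1 + c2) c1) => //.
  (* The degree condition says c1 + c2 = b - ea + e d1, so the code is PRS(c1 + c2 + 1). *)
  rewrite -cb subrK -PoszD -[1]/(1%:Z) -PoszD addn1 PRS_sum //.
  have c1c : (c1 < (c1 + c2).+1)%N by rewrite ltnS leq_addr.
  by apply: (subvP (sumv_sup (Ordinal c1c) _ (subvv _))); rewrite ?memv_line.
case/memv_sumP=> G GT ->; apply: Ce_sum => d1 _.
have /memv_tensor_line := GT d1 isT.
case=> [|u uP ->]; first exact: xvec_neq0.
(* The dimension parameter is zero, d + 1 or negative; in the outer cases the code is zero, hence so
   is the matrix. *)
case deg: (_ + 1) uP => [[|d]|d]; rewrite ?PRS_sum //.
- rewrite memv0 => /eqP ->; rewrite trmx0 mul0mx.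
  by exists 0; [exact: in_span0 | rewrite eval_mx0].
- case/memv_sumP=> v vL ->; rewrite raddf_sum mulmx_suml.
  apply: Ce_sum => k _; have /vlineP [c ->] := vL k isT.
  have kd : (k <= d)%N by rewrite -ltnS.
  have da : (d1 <= a)%N by rewrite -ltnS.
  (* Here d = b - ea + e d1 by [deg], so T-exponents k and d - k satisfy the degree condition. *)
  exists (c *: 'X_[Multinom [tuple (d1 : nat); (a - d1)%N; (k : nat); (d - k)%N]]).
    apply: in_spanZ; apply: in_span_gen.
    exists d1, (a - d1)%N, k, (d - k)%N; split; rewrite ?subnKC //.
    rewrite -PoszD subnKC //; apply/eqP; rewrite subr_eq; apply/eqP/(addIr 1).
    by rewrite deg -PoszD addn1.
  by rewrite eval_mxZ eval_mx_monomial !subnKC //= linearZ /= -scalemxAl.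
- rewrite memv0 => /eqP ->; rewrite trmx0 mul0mx.
  by exists 0; [exact: in_span0 | rewrite eval_mx0].
Qed.
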